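(* Let $\beta\in(0,1]$ and let $H^2(\beta)$ be the weighted Hardy space with weights $\beta_n^2=(1/\beta)^n$. Let $A$ be the finite rank operator $A(f)=\sum_{i=1}^n\langle f,g_i\rangle g_i$, where $f,g_i\in H^2(\beta)$. Then the Berezin range $\mathrm{Ber}(A)$ is a convex subset of $\mathbb{C}$.
   Context: $\mathbb D$ is the open unit disc in $\mathbb{C}$. For $\beta\in(0,1]$ and $\beta_n^2=(1/\beta)^n$, $H^2(\beta)$ is the Hilbert space of $f(z)=\sum_{n\ge0}a_nz^n$ with $\sum_n|a_n|^2\beta_n^2<\infty$ and inner product $\langle f,g\rangle=\sum_n a_n\overline{b_n}\beta_n^2$ (where $g(z)=\sum_n b_nz^n$), viewed as a reproducing kernel Hilbert space of analytic functions on $\mathbb D$ with reproducing kernel $k_w(z)=\frac{1}{1-\beta\overline{w}z}$, $w,z\in\mathbb D$. With $\hat k_w=k_w/\|k_w\|$, the Berezin transform of a bounded operator $A$ is $\widetilde A(w)=\langle A\hat k_w,\hat k_w\rangle$ and its Berezin range is $\mathrm{Ber}(A)=\{\widetilde A(w):w\in\mathbb D\}\subset\mathbb C$. *)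

(* Defs.v *)
From HB Require Import structures.
From mathcomp Require Import all_boot all_order all_algebra.
From mathcomp Require Import complex.
From mathcomp Require Import all_classical all_reals all_analysis.
From mathcomp Require Import ring lra.

Set Implicit Arguments.
Unset Strict Implicit.
Unset Printing Implicit Defensive.
Import Order.TTheory GRing.Theory Num.Theory.
Import numFieldNormedType.Exports.

(* The half-open interval (0, 1]; with classical_set_scope open, `]0, 1] would
   denote a set instead of an [interval int]. *)
Notation oc01 R := {itv R & `]0%Z, 1%Z]%O}.

Local Open Scope classical_set_scope.
Local Open Scope ring_scope.
Local Open Scope complex_scope.

Import Normc.

(* R[i]^o is R[i] with the topology of its complex modulus. *)
Definition csum (R : realType) (u : nat -> R[i]) : R[i] :=
  limn (series (u : nat -> R[i]^o)).

Definition disc (R : realType) := {w : R[i] | `|w| < 1}.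

(* The squared weight beta_n^2, not beta_n itself. *)
Definition weight (R : realType) (beta : oc01 R) (n : nat) : R :=
  (1 / beta%:num) ^+ n.

Lemma weight_ge0 (R : realType) (beta : oc01 R) n : 0 <= weight beta n.
Proof. by rewrite exprn_ge0// divr_ge0. Qed.

Definition h2_pred (R : realType) (beta : oc01 R) : {pred nat -> R[i]} :=
  fun a => (\sum_(n <oo) (normc (a n) ^+ 2 * weight beta n)%:E < +oo)%E.

Lemma normc_ge0 (R : realType) (z : R[i]) : 0 <= normc z.
Proof. by case: z => x y; exact: sqrtr_ge0. Qed.

Lemma h2_term_ge0 (R : realType) (beta : oc01 R) (a : nat -> R[i]) n :
  (0 <= (normc (a n) ^+ 2 * weight beta n)%:E)%E.
Proof. by rewrite lee_fin mulr_ge0 ?weight_ge0// exprn_ge0// normc_ge0. Qed.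

Lemma h2_submod_closed (R : realType) (beta : oc01 R) :
  submod_closed (h2_pred beta).
Proof.
split=> [|c a b].
  rewrite unfold_in eseries0 ?ltry// => n _ _ /=.
  by rewrite expr0n addr0 sqrtr0 expr0n mul0r.
rewrite !unfold_in => ha hb.
apply: (@le_lt_trans _ _
  (\sum_(n <oo) ((2 * normc c ^+ 2)%:E * (normc (a n) ^+ 2 * weight beta n)%:E
     + 2%:E * (normc (b n) ^+ 2 * weight beta n)%:E))%E).
  apply: lee_nneseries => n *; first exact: h2_term_ge0.
  rewrite -!EFinM -EFinD lee_fin !mulrA -mulrDl ler_wpM2r ?weight_ge0//.
  apply: (@le_trans _ _ ((normc (c * a n) + normc (b n)) ^+ 2)).
    by rewrite ler_sqr ?nnegrE ?addr_ge0 ?normc_ge0// le_normcD.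
  rewrite normcM; set x := normc c * _; set y := normc (b n).
  rewrite -subr_ge0 (_ : _ - _ = (x - y) ^+ 2) ?sqr_ge0//.
  by rewrite /x; ring.
rewrite nneseriesD; last 2 first.
- by move=> *; rewrite mule_ge0 ?h2_term_ge0// lee_fin mulr_ge0// sqr_ge0.
- by move=> *; rewrite mule_ge0 ?h2_term_ge0.
rewrite !nneseriesZl; try by move=> *; exact: h2_term_ge0.
by rewrite lte_add_pinfty// lte_mul_pinfty// ?lee_fin ?mulr_ge0 ?normc_ge0.
Qed.

HB.instance Definition _ (R : realType) (beta : oc01 R) :=
  GRing.isSubmodClosed.Build _ _ (h2_pred beta) (@h2_submod_closed R beta).

(* An element of H^2(beta) is stored as its sequence of Taylor coefficients; the
   function it stands for is [h2_eval]. *)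
Record h2 (R : realType) (beta : oc01 R) := H2 {
  h2_coef :> nat -> R[i];
  h2_coefP : h2_coef \in h2_pred beta }.

Section h2_lmodule.
Variables (R : realType) (beta : oc01 R).

HB.instance Definition _ := [isSub for @h2_coef R beta].
HB.instance Definition _ := [Choice of h2 beta by <:].
HB.instance Definition _ := [SubChoice_isSubLmodule of h2 beta by <:].

End h2_lmodule.

Section complex_series.
Variable R : realType.

Lemma cvg_real_complex (u : nat -> R) (l : R) :
  u @ \oo --> l -> (fun n => (u n)%:C : R[i]^o) @ \oo --> (l%:C : R[i]^o).
Proof.
move=> ul; apply/cvgrPdist_lt => e e0.
have [r0 er] : 0 < complex.Re e /\ e = (complex.Re e)%:C.
  case: e e0 => a b; rewrite ltcE/= => /andP[/eqP -> a0]; split=> //.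
move/cvgrPdist_lt : ul => /(_ _ r0); apply: filterS => n.
by rewrite er -rmorphB/= normc_def/= expr0n/= addr0 sqrtr_sqr ltcR.
Qed.

Lemma cvg_csum (u : nat -> R[i]) :
  cvgn (series (@complex.Re R \o u)) -> cvgn (series (@complex.Im R \o u)) ->
  cvgn (series (u : nat -> R[i]^o)).
Proof.
move=> /cvg_ex[x xP] /cvg_ex[y yP].
apply/cvg_ex; exists (x%:C + 'i%C * y%:C : R[i]^o).
rewrite (_ : series _ = (fun n => (series (@complex.Re R \o u) n)%:C : R[i]^o) \+
   (fun n => 'i%C * (series (@complex.Im R \o u) n)%:C : R[i]^o)); last first.
  apply/funext => n /=; rewrite /series/= !rmorph_sum/= mulr_sumr -big_split/=.
  by apply: eq_bigr => i _; rewrite -complexE.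
apply: cvgD; first exact: cvg_real_complex.
by apply: cvgMl_tmp; exact: cvg_real_complex.
Qed.

Lemma le_Re_normc (z : R[i]) : `|complex.Re z| <= normc z.
Proof.
by case: z => a b /=; rewrite -sqrtr_sqr ler_wsqrtr// lerDl sqr_ge0.
Qed.

Lemma le_Im_normc (z : R[i]) : `|complex.Im z| <= normc z.
Proof.
by case: z => a b /=; rewrite -sqrtr_sqr ler_wsqrtr// lerDr sqr_ge0.
Qed.

Lemma abs_cvg_csum (u : nat -> R[i]) :
  (\sum_(n <oo) (normc (u n))%:E < +oo)%E -> cvgn (series (u : nat -> R[i]^o)).
Proof.
move=> u_fin.
have cu : cvgn (series (fun n => normc (u n))).
  by apply: nnseries_is_cvg => // n; exact: normc_ge0.
by apply: cvg_csum; apply: normed_cvg;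
  apply: series_le_cvg cu => n /=; rewrite ?normc_ge0 ?le_Re_normc ?le_Im_normc.
Qed.

Lemma normcX (z : R[i]) n : normc (z ^+ n) = normc z ^+ n.
Proof.
by elim: n => [|n ih]; rewrite ?expr0 ?normc1// !exprS normcM ih.
Qed.

Lemma csum_geometric (q : R[i]) : `|q| < 1 -> csum (fun n => q ^+ n) = 1 / (1 - q).
Proof.
move=> q1; apply: (@cvg_lim _ (@norm_hausdorff R[i] R[i]^o)).
have -> : (fun n => q ^+ n) = geometric 1 q by rewrite -exprn_geometric.
rewrite geometric_seriesE; last first.
  by apply: contraTneq q1 => ->; rewrite normr1 ltxx.
have -> : 1 / (1 - q) = 1 * (1 - 0) / (1 - q) by rewrite subr0 mulr1.
apply: cvgMr_tmp; apply: cvgMl_tmp; apply: cvgB; first exact: cvg_cst.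
apply/norm_cvg0P.
have -> : (fun n => `|q ^+ n|) = (fun n => (geometric 1 (normc q) n)%:C).
  apply/funext => n; rewrite normrX /geometric/= mul1r rmorphXn/=.
  by congr (_ ^+ _); case: q {q1}.
apply: cvg_real_complex; apply: cvg_geometric.
rewrite ger0_norm ?normc_ge0// -ltcR.
by case: q q1.
Qed.

End complex_series.

Section h2_theory.
Variables (R : realType) (beta : oc01 R).
Implicit Types (f g : h2 beta) (w z : disc R).

Definition h2_eval f z : R[i] := csum (fun n => f n * val z ^+ n).

Definition h2_dot f g : R[i] :=
  csum (fun n => f n * (g n)^* * (weight beta n)%:C).

Lemma h2_dot_cvg f g :
  cvgn (series (fun n => f n * (g n)^* * (weight beta n)%:C : R[i]^o)).
Proof.
apply: abs_cvg_csum; apply: (@le_lt_trans _ _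
  (\sum_(n <oo) ((normc (f n) ^+ 2 * weight beta n)%:E
     + (normc (g n) ^+ 2 * weight beta n)%:E))%E).
  apply: lee_nneseries => n *; first by rewrite lee_fin normc_ge0.
  rewrite -EFinD lee_fin -mulrDl !normcM [normc (weight _ _)%:C]/= expr0n/= addr0.
  rewrite sqrtr_sqr ger0_norm ?weight_ge0// ler_wpM2r ?weight_ge0//.
  rewrite (_ : normc (g n)^* = normc (g n)); last first.
    by case: (g n) => a b /=; rewrite sqrrN.
  set x := normc (f n); set y := normc (g n).
  by have := normc_ge0 (f n); have := normc_ge0 (g n); rewrite -/x -/y; nra.
rewrite nneseriesD; try by move=> *; exact: h2_term_ge0.
apply: lte_add_pinfty; first exact: (h2_coefP f).
exact: (h2_coefP g).
Qed.

Definition h2_norm f : R[i] := sqrtC (h2_dot f f).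

(* Taylor coefficients at 0 of z |-> 1 / (1 - beta conj(w) z); see [kernelE] and
   [h2_reproducing]. *)
Definition kernel_coef w (n : nat) : R[i] := (beta%:num%:C * (val w)^*) ^+ n.

Lemma beta_gt0 : 0 < beta%:num. Proof. by []. Qed.

Lemma beta_le1 : beta%:num <= 1. Proof. by []. Qed.

Lemma kernel_coefP w : kernel_coef w \in h2_pred beta.
Proof.
have w1 : normc (val w) < 1 by rewrite -ltcR; case: w => -[].
have [b0 b1] := (beta_gt0, beta_le1).
have x1 : beta%:num * normc (val w) ^+ 2 < 1.
  by have := normc_ge0 (val w); nra.
have xE n : normc (kernel_coef w n) ^+ 2 * weight beta n =
    (beta%:num * normc (val w) ^+ 2) ^+ n.
  rewrite normcX normcM [normc _%:C]/= expr0n/= addr0 sqrtr_sqr ger0_norm//.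
  rewrite (_ : normc (val w)^* = normc (val w)); last first.
    by case: (val w) => a b /=; rewrite sqrrN.
  rewrite /weight -exprM mulnC exprM -exprMn; congr (_ ^+ _).
  by rewrite exprMn; field; rewrite gt_eqF.
rewrite unfold_in; under eq_eseriesr do rewrite xE.
set x := beta%:num * _ in x1 *.
rewrite (_ : (fun n => _) = EFin \o series (geometric 1 x)); last first.
  apply/funext => n /=; rewrite -sumEFin.
  by apply: eq_bigr => k _; rewrite /geometric/= mul1r.
rewrite EFin_lim ?ltry//; apply: is_cvg_geometric_series.
by rewrite ger0_norm// mulr_ge0// sqr_ge0.
Qed.

Definition kernel w : h2 beta := H2 (kernel_coefP w).

Lemma kernelE w z :
  h2_eval (kernel w) z = 1 / (1 - beta%:num%:C * (val w)^* * val z).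
Proof.
rewrite /h2_eval -csum_geometric.
  by congr csum; apply/funext => n; rewrite exprMn.
have [w1 z1] := (valP w, valP z).
have b1 : `|beta%:num%:C : R[i]| <= 1.
  by rewrite normc_def/= expr0n/= addr0 sqrtr_sqr ger0_norm// lecR.
rewrite !normrM normcJ; apply: le_lt_trans z1.
by rewrite ler_piMl// mulr_ile1// ltW.
Qed.

Lemma h2_reproducing f w : h2_dot f (kernel w) = h2_eval f w.
Proof.
congr csum; apply/funext => n; rewrite -mulrA; congr (_ * _).
rewrite /= /kernel_coef rmorphXn/= rmorphM/=.
rewrite [X in (_ * X) ^+ n](_ : _ = sval w); last exact: conjcK.
rewrite /weight; have : beta%:num != 0 :> R by rewrite gt_eqF.
move: (beta%:num) => b b0; rewrite rmorphXn/= -exprMn; congr (_ ^+ _).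
rewrite [X in X * _ * _](_ : _ = b%:C); last by apply/eqP; rewrite eq_complex/= oppr0 !eqxx.
by rewrite mulrAC -rmorphM/= mul1r divff// mul1r.
Qed.

Definition normalized_kernel w : h2 beta := (h2_norm (kernel w))^-1 *: kernel w.

Definition berezin (A : h2 beta -> h2 beta) w : R[i] :=
  h2_dot (A (normalized_kernel w)) (normalized_kernel w).

Definition berezin_range (A : h2 beta -> h2 beta) : set R[i] := range (berezin A).

End h2_theory.

(* Main.v *)
Require Import Defs.
From mathcomp Require Import all_boot all_order all_algebra.
From mathcomp Require Import complex.
From mathcomp Require Import all_classical all_reals all_analysis.
From mathcomp Require Import ring lra.
Set Implicit Arguments.
Unset Strict Implicit.
Unset Printing Implicit Defensive.
Import Order.TTheory GRing.Theory Num.Theory.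
Import numFieldNormedType.Exports.
Local Open Scope ring_scope.

Import Normc.

(** For a unit kernel [k] at [w], the operator [A f = \sum_i <f, g_i> g_i] gives
    [<A k, k> = \sum_i |<g_i, k>|^2], and the reproducing property turns this
    into the nonnegative real number
      [(1 - beta |w|^2) * \sum_i |g_i(w)|^2]
    ([berezin_sum_rank1]).  The Berezin range is thus the image in the real axis
    of a real function on the disc.  That function is continuous and the disc is
    convex, hence connected, so the image is an interval, which is convex.

    In practice, to reach a convex combination of the values at [z] and [w], the
    function is restricted to the segment joining them and the intermediate value
    theorem is applied on [0, 1] ([berezin_ivt]).  The segment stays in a closed
    disc of radius [r < 1], where every [f] of the space is Lipschitz
    ([h2_eval_lipschitz]): its Taylor coefficients are bounded by a constant [C],
    because the weights are at least 1, and [|z^n - w^n| <= |z - w| n r^(n-1)], so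
    [C / (1 - r)^2] is a Lipschitz constant.  Working with Lipschitz bounds between
    real moduli keeps all continuity arguments inside the real line. *)

(** * The complex modulus and complex series *)

Section modulus_and_series.
Local Open Scope classical_set_scope.
Local Open Scope complex_scope.
Variable R : realType.
Implicit Types (u v : nat -> R[i]) (z : R[i]).

Lemma norm_normc z : `|z| = (normc z)%:C.
Proof. by case: z. Qed.

Lemma normcJ z : normc z^*%R = normc z.
Proof. by case: z => a b /=; rewrite sqrrN. Qed.

Lemma normc_sum (I : Type) (r : seq I) (P : pred I) (F : I -> R[i]) :
  normc (\sum_(i <- r | P i) F i) <= \sum_(i <- r | P i) normc (F i).
Proof.
elim/big_ind2 : _ => [|x a y b xa yb|//]; first by rewrite normc0.
exact: le_trans (le_normcD _ _) (lerD xa yb).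
Qed.


Lemma normc_dist (z w : R[i]) : `|normc z - normc w| <= normc (z - w).
Proof.
have h (x y : R[i]) : normc x - normc y <= normc (x - y).
  by rewrite lerBlDr -[x in leLHS](subrK y) le_normcD.
rewrite ler_norml h andbT lerNl opprB.
by apply: le_trans (h _ _) _; rewrite -[leRHS]normcN opprB.
Qed.

Lemma normc_convex (z w : R[i]) (t : R) : 0 <= t <= 1 ->
  normc (t%:C * z + (1 - t)%:C * w) <= Num.max (normc z) (normc w).
Proof.
move=> /andP[t0 t1]; apply: le_trans (le_normcD _ _) _.
have nC (x : R) : 0 <= x -> normc x%:C = x.
  by move=> x0; rewrite /= expr0n/= addr0 sqrtr_sqr ger0_norm.
rewrite !normcM !nC ?subr_ge0//; set m := Num.max _ _.
have zm : normc z <= m by rewrite le_max lexx.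
have wm : normc w <= m by rewrite le_max lexx orbT.
have -> : m = t * m + (1 - t) * m by ring.
by rewrite lerD// ler_wpM2l// subr_ge0.
Qed.

Lemma csum_cvg u : cvgn (series (u : nat -> R[i]^o)) ->
  series (u : nat -> R[i]^o) @ \oo --> (csum u : R[i]^o).
Proof. by []. Qed.

Lemma csumE u (l : R[i]) : series (u : nat -> R[i]^o) @ \oo --> (l : R[i]^o) ->
  csum u = l.
Proof. exact: (@cvg_lim _ (@norm_hausdorff R[i] R[i]^o)). Qed.

Lemma csumD u v : cvgn (series (u : nat -> R[i]^o)) ->
  cvgn (series (v : nat -> R[i]^o)) -> csum (fun n => u n + v n) = csum u + csum v.
Proof.
move=> /csum_cvg cu /csum_cvg cv; apply: csumE.
have -> : series (fun n => u n + v n : R[i]^o) =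
    series (u : nat -> R[i]^o) \+ series (v : nat -> R[i]^o).
  by apply/funext => n; rewrite /series/= big_split.
by have := cvgD cu cv; apply.
Qed.

Lemma csumZ (c : R[i]) u : cvgn (series (u : nat -> R[i]^o)) ->
  csum (fun n => c * u n) = c * csum u.
Proof.
move=> /csum_cvg cu; apply: csumE.
have -> : series (fun n => c * u n : R[i]^o) =
    (fun n => c * series (u : nat -> R[i]^o) n).
  by apply/funext => n; rewrite /series/= mulr_sumr.
by have := @cvgMl_tmp _ _ _ _ _ c _ cu; apply.
Qed.

Lemma csumJ u : cvgn (series (u : nat -> R[i]^o)) ->
  csum (fun n => (u n)^*%R) = (csum u)^*%R.
Proof.
move=> /csum_cvg cu; apply: csumE; apply/cvgrPdist_lt => e e0.
move/cvgrPdist_lt : cu => /(_ _ e0); apply: filterS => n.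
rewrite /series/= -rmorph_sum -rmorphB.
by rewrite [X in _ -> X < _]norm_normc normcJ -norm_normc.
Qed.

(** A bound on all partial sums of the termwise distances passes to the limit
    because closed balls are closed. *)
Lemma normc_csumB u v (M : R) : cvgn (series (u : nat -> R[i]^o)) ->
  cvgn (series (v : nat -> R[i]^o)) ->
  (forall N, \sum_(n < N) normc (u n - v n) <= M) ->
  normc (csum u - csum v) <= M.
Proof.
move=> /csum_cvg cu /csum_cvg cv uvM; rewrite leNgt; apply/negP => Mlt.
have /cvgr_norm_gt : series (u : nat -> R[i]^o) n - series (v : nat -> R[i]^o) n
   @[n --> \oo] --> (csum u - csum v : R[i]^o) by have := cvgB cu cv; apply.
move=> /(_ M%:C); rewrite norm_normc ltcR => /(_ Mlt)[N _ /(_ N (leqnn N))].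
rewrite /= norm_normc ltcR ltNge => /negP; apply.
rewrite /series/= -sumrB big_mkord.
exact: le_trans (normc_sum _ _ _) (uvM N).
Qed.

(** The partial sums of the derivative of the geometric series, whose sum is
    [1 / (1 - r)^2]; the closed form used in the proof bounds them without
    differentiating the limit. *)
Lemma sum_geometric_deriv_le (r : R) N : 0 <= r < 1 ->
  \sum_(n < N) n%:R * r ^+ n.-1 <= (1 - r) ^- 2.
Proof.
move=> /andP[r0 r1].
have r10 : 0 < 1 - r by rewrite subr_gt0.
rewrite -[leRHS]mul1r ler_pdivlMr ?exprn_gt0//.
suff -> : (\sum_(n < N) n%:R * r ^+ n.-1) * (1 - r) ^+ 2 =
    1 - N%:R * r ^+ N.-1 * (1 - r) - r ^+ N.
  have ? := exprn_ge0 N r0.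
  have : 0 <= N%:R * r ^+ N.-1 * (1 - r).
    by rewrite !mulr_ge0 ?ler0n ?exprn_ge0// ltW.
  lra.
elim: N => [|N ih]; first by rewrite big_ord0 expr0; ring.
rewrite big_ord_recr/= mulrDl {}ih -natr1.
case: N => [|N] /=; first by rewrite !expr0 expr1; ring.
by rewrite -!natr1 !exprS; ring.
Qed.

(** Factoring out [z - w] leaves [n] monomials of degree [n - 1], each of modulus
    at most [r^(n-1)]. *)
Lemma normcBX (z w : R[i]) (r : R) n : normc z <= r -> normc w <= r ->
  normc (z ^+ n - w ^+ n) <= normc (z - w) * (n%:R * r ^+ n.-1).
Proof.
move=> zr wr; rewrite subrXX normcM ler_wpM2l ?normc_ge0//.
apply: le_trans (normc_sum _ _ _) _.
have -> : n%:R * r ^+ n.-1 = \sum_(i < n) r ^+ n.-1.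
  by rewrite sumr_const card_ord mulr_natl.
apply: ler_sum => i _.
have -> : n.-1 = (n.-1 - i + i)%N by rewrite subnK// -ltnS (ltn_predK (ltn_ord i)).
have r0 : 0 <= r by exact: le_trans (normc_ge0 z) zr.
rewrite addnK normcM !normcX exprD.
by rewrite ler_pM ?exprn_ge0 ?normc_ge0// lerXn2r ?nnegrE ?normc_ge0.
Qed.

End modulus_and_series.

(** * The space H^2(beta) and the Berezin transform *)

Section h2_space.
Local Open Scope classical_set_scope.
Local Open Scope complex_scope.
Variables (R : realType) (beta : oc01 R).
Implicit Types (f g h : h2 beta) (w z : disc R).

Lemma normc_disc w : normc (val w) < 1.
Proof. by rewrite -ltcR -norm_normc; exact: (valP w). Qed.

Lemma h2_dotJ f g : (h2_dot f g)^*%R = h2_dot g f.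
Proof.
rewrite -csumJ; last exact: h2_dot_cvg.
congr csum; apply/funext => n.
rewrite !rmorphM [X in _ * X * _](_ : _ = g n); last exact: conjcK.
by rewrite [_ * g n]mulrC; congr (_ * _); exact: conjc_real.
Qed.

Lemma h2_dotDl f g h : h2_dot (f + g) h = h2_dot f h + h2_dot g h.
Proof.
rewrite -csumD; try exact: h2_dot_cvg.
by congr csum; apply/funext => n; rewrite -!mulrDl.
Qed.

Lemma h2_dotZl (c : R[i]) f h : h2_dot (c *: f) h = c * h2_dot f h.
Proof.
rewrite -csumZ; last exact: h2_dot_cvg.
by congr csum; apply/funext => n; rewrite !mulrA.
Qed.

Lemma h2_dotZr (c : R[i]) f h : h2_dot f (c *: h) = c^* * h2_dot f h.
Proof. by rewrite -h2_dotJ h2_dotZl rmorphM/= h2_dotJ. Qed.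

Lemma h2_dot_suml (n : nat) (f : 'I_n -> h2 beta) h :
  h2_dot (\sum_(i < n) f i) h = \sum_(i < n) h2_dot (f i) h.
Proof.
elim/big_ind2 : _ => [|f1 x1 f2 x2 <- <-|//]; last exact: h2_dotDl.
by rewrite -[X in h2_dot X _](scale0r (0 : h2 beta)) h2_dotZl mul0r.
Qed.

(** All weights are at least 1, since [beta <= 1], so each [|f_n|^2] is bounded by
    the squared norm of [f]. *)
Lemma h2_coef_bounded f : exists2 M : R, 0 <= M & forall n, normc (f n) <= M.
Proof.
have := h2_coefP f; rewrite unfold_in.
have ge0 n : (0 <= (normc (f n) ^+ 2 * weight beta n)%:E)%E by exact: h2_term_ge0.
set S := (\sum_(n <oo) _)%E => Sfin.
have S0 : (0 <= S)%E by exact: nneseries_ge0.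
have SE : S = (fine S)%:E by rewrite fineK// ge0_fin_numE.
(* [x^2 <= S] gives [x <= 1 + S], which avoids the square root of [S]. *)
exists (1 + fine S) => [|n]; first by rewrite addr_ge0// fine_ge0.
have : ((normc (f n) ^+ 2 * weight beta n)%:E <= S)%E.
  have := @nneseries_lim_ge _ (fun n => (normc (f n) ^+ 2 * weight beta n)%:E)
    xpredT 0 n.+1 (fun k _ _ => ge0 k).
  apply: le_trans; rewrite big_nat_recr//= leeDr//.
  by apply: sume_ge0 => k _; exact: ge0.
rewrite SE lee_fin => fS.
have w1 : 1 <= weight beta n.
  by rewrite exprn_ege1// lter_pdivlMr ?mul1r ?beta_le1 ?beta_gt0.
have : normc (f n) ^+ 2 <= fine S.
  by apply: le_trans fS; rewrite ler_peMr// sqr_ge0.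
by nra.
Qed.

Lemma h2_eval_cvg f w : cvgn (series (fun n => f n * val w ^+ n : R[i]^o)).
Proof.
have [M M0 fM] := h2_coef_bounded f; have w1 := normc_disc w.
have w0 := normc_ge0 (val w).
apply: abs_cvg_csum; apply: (@le_lt_trans _ _
  (\sum_(n <oo) (geometric M (normc (val w)) n)%:E)%E).
  apply: lee_nneseries => n *; first by rewrite lee_fin normc_ge0.
  by rewrite lee_fin normcM normcX /= ler_wpM2r// exprn_ge0.
rewrite (_ : (fun n => _) = EFin \o series (geometric M (normc (val w)))); last first.
  by apply/funext => n /=; rewrite -sumEFin.
rewrite EFin_lim ?ltry//; apply: is_cvg_geometric_series.
by rewrite ger0_norm.
Qed.

(** Away from the boundary circle the Taylor series can be compared term by term,
    with Lipschitz constant [\sum_n C n r^(n-1) = C / (1 - r)^2]. *)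
Lemma h2_eval_lipschitz f (r : R) : r < 1 -> exists M : R, forall z w,
  normc (val z) <= r -> normc (val w) <= r ->
  normc (h2_eval f z - h2_eval f w) <= M * normc (val z - val w).
Proof.
move=> r1; have [C C0 fC] := h2_coef_bounded f.
exists (C * (1 - r) ^- 2) => z w zr wr.
have r0 : 0 <= r by exact: le_trans (normc_ge0 (val z)) zr.
apply: normc_csumB; try exact: h2_eval_cvg.
move=> N; apply: (@le_trans _ _
  (\sum_(n < N) C * normc (val z - val w) * (n%:R * r ^+ n.-1))).
  apply: ler_sum => n _; rewrite -mulrBr normcM -mulrA.
  by rewrite ler_pM ?normc_ge0// normcBX.
rewrite -mulr_sumr [leRHS]mulrAC ler_wpM2l ?mulr_ge0 ?normc_ge0//.
by apply: sum_geometric_deriv_le; rewrite r0.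
Qed.

(** The Berezin transform of [\sum_i <., g_i> g_i] as a real function; see
    [berezin_sum_rank1]. *)
Definition berezin_real (n : nat) (g : 'I_n -> h2 beta) w : R :=
  (1 - beta%:num * normc (val w) ^+ 2) *
  \sum_(i < n) normc (h2_eval (g i) w) ^+ 2.

Lemma sqr_norm_normc (x : R[i]) : x^* * x = (normc x ^+ 2)%:C.
Proof. by rewrite mulrC rmorphXn/= -norm_normc sqr_normc. Qed.

Lemma real_complex_1BM (a b : R) : 1 - a%:C * b%:C = (1 - a * b)%:C :> R[i].
Proof. by rewrite -rmorphM -[1](rmorph1 (real_complex R)) -rmorphB. Qed.

(** The squared norm of the kernel at [w] is its own value at [w], namely
    [1 / (1 - beta |w|^2)]. *)
Lemma h2_norm_kernel w :
  (h2_norm (Defs.kernel beta w))^-1 ^+ 2 = (1 - beta%:num * normc (val w) ^+ 2)%:C.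
Proof.
rewrite exprVn sqrtCK h2_reproducing kernelE div1r invrK -mulrA.
by rewrite sqr_norm_normc real_complex_1BM.
Qed.

(** With [k = c *: kernel w] and [c] real, both [<k, g_i>] and [<g_i, k>] contribute
    a factor [c], and [c^2 = 1 - beta |w|^2]; the reproducing property evaluates
    the remaining product of two conjugate factors. *)
Lemma berezin_sum_rank1 (n : nat) (g : 'I_n -> h2 beta) w :
  berezin (fun f => \sum_(i < n) h2_dot f (g i) *: g i) w =
  (berezin_real g w)%:C.
Proof.
rewrite /berezin /normalized_kernel /berezin_real.
set c := (h2_norm _)^-1.
(* The norm of the kernel is the square root of a nonnegative number. *)
have cJ : c^*%R = c.
  apply: conj_Creal; apply: ger0_real; rewrite invr_ge0 sqrtC_ge0.
  rewrite h2_reproducing kernelE -mulrA sqr_norm_normc real_complex_1BM.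
  have := normc_disc w; have := normc_ge0 (val w).
  have := beta_gt0 beta; have := beta_le1 beta => b1 b0 w0 w1.
  by rewrite div1r invr_ge0 ler0c subr_ge0; nra.
rewrite h2_dot_suml [RHS]rmorphM [X in _ = X * _](_ : _ = c ^+ 2); last first.
  by rewrite h2_norm_kernel.
rewrite rmorph_sum mulr_sumr; apply: eq_bigr => i _.
rewrite !h2_dotZl h2_dotZr cJ -[h2_dot _ (g i)]h2_dotJ h2_reproducing.
rewrite [X in _ = _ * X](_ : _ = (h2_eval (g i) w)^*%R * h2_eval (g i) w).
  by rewrite mulrA -!mulrA [X in c * X]mulrCA !mulrA -expr2.
by rewrite sqr_norm_normc.
Qed.

End h2_space.

(** * Continuity along segments of the disc *)

Section segment.
Local Open Scope classical_set_scope.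
Local Open Scope complex_scope.
Variables (R : realType) (beta : oc01 R).

Lemma lipschitz_within_continuous (a b M : R) (phi : R -> R) :
  (forall s t, a <= s <= b -> a <= t <= b ->
    `|phi s - phi t| <= M * `|s - t|) ->
  {within `[a, b], continuous phi}.
Proof.
move=> phiM; apply/subspace_continuousP => s; rewrite /= in_itv/= => sab.
apply/cvgrPdist_lt => e e0; rewrite near_withinE.
(* [`|M| + 1] replaces [M], which may vanish or be negative, as a divisor. *)
have M0 : 0 < `|M| + 1 by rewrite ltr_wpDl.
near=> t; rewrite /= in_itv/= => tab; apply: le_lt_trans (phiM _ _ sab tab) _.
apply: (@le_lt_trans _ _ ((`|M| + 1) * `|s - t|)).
  by rewrite ler_wpM2r// (le_trans (ler_norm M))// lerDl.
rewrite mulrC -ltr_pdivlMr//; near: t.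
by apply: cvgr_dist_lt; rewrite ?divr_gt0//; exact: cvg_id.
Unshelve. all: by end_near. Qed.

(** The intermediate value theorem wants a function of every real [t], so points
    of the line that lie outside of the disc are replaced with [z]. *)
Definition disc_segment (z w : disc R) (t : R) : disc R :=
  insubd z (t%:C * val z + (1 - t)%:C * val w).

Lemma disc_segmentE (z w : disc R) (t : R) : 0 <= t <= 1 ->
  val (disc_segment z w t) = t%:C * val z + (1 - t)%:C * val w.
Proof.
move=> t01; rewrite /disc_segment insubdK// -topredE/=.
rewrite norm_normc ltcR; apply: le_lt_trans (normc_convex _ _ t01) _.
by rewrite gt_max !normc_disc.
Qed.

Lemma disc_segment0 (z w : disc R) : disc_segment z w 0 = w.
Proof.
by apply: val_inj; rewrite disc_segmentE ?lexx ?ler01// mul0r add0r subr0 mul1r.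
Qed.

Lemma disc_segment1 (z w : disc R) : disc_segment z w 1 = z.
Proof.
by apply: val_inj; rewrite disc_segmentE ?lexx ?ler01// subrr mul0r addr0 mul1r.
Qed.

Lemma disc_segment_dist (z w : disc R) (s t : R) :
  0 <= s <= 1 -> 0 <= t <= 1 ->
  normc (val (disc_segment z w s) - val (disc_segment z w t)) =
  `|s - t| * normc (val z - val w).
Proof.
move=> s01 t01; rewrite !disc_segmentE//.
have -> : s%:C * val z + (1 - s)%:C * val w - (t%:C * val z + (1 - t)%:C * val w) =
    (s - t)%:C * (val z - val w).
  by rewrite !rmorphB rmorph1; ring.
by rewrite normcM [normc _%:C]/= expr0n/= addr0 sqrtr_sqr.
Qed.

Lemma continuous_normc_eval (f : h2 beta) (z w : disc R) :
  {within `[0, 1], continuous (fun t => normc (h2_eval f (disc_segment z w t)))}.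
Proof.
(* The segment lies in the closed disc through its endpoint of larger modulus. *)
have r1 : Num.max (normc (val z)) (normc (val w)) < 1 by rewrite gt_max !normc_disc.
have [M fM] := h2_eval_lipschitz f r1.
apply: (@lipschitz_within_continuous _ _ (M * normc (val z - val w))) => s t s01 t01.
apply: le_trans (normc_dist _ _) _.
rewrite mulrAC -mulrA -disc_segment_dist//.
by apply: fM; rewrite disc_segmentE// normc_convex.
Qed.

Lemma continuous_normc_segment (z w : disc R) :
  {within `[0, 1], continuous (fun t => normc (val (disc_segment z w t)))}.
Proof.
apply: (@lipschitz_within_continuous _ _ (normc (val z - val w))) => s t s01 t01.
apply: le_trans (normc_dist _ _) _.
by rewrite mulrC disc_segment_dist.
Qed.

Lemma continuous_berezin_real (n : nat) (g : 'I_n -> h2 beta) (z w : disc R) :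
  {within `[0, 1],
    continuous (fun t => berezin_real g (disc_segment z w t))}.
Proof.
pose T := subspace (`[0, 1] : set R).
have sqr (u : T -> R) : continuous u -> continuous (fun t => u t ^+ 2 : R).
  by move=> cu t; apply: continuousM; exact: cu.
have scale (c : R) (u : T -> R) : continuous u -> continuous (fun t => c * u t : R).
  by move=> cu t; apply: continuousM; [exact: cst_continuous|exact: cu].
have sub1 (u : T -> R) : continuous u -> continuous (fun t => 1 - u t : R).
  by move=> cu t; have := continuousB (@cst_continuous T R 1 t) (cu t); apply.
have sum (I : Type) (r : seq I) (u : I -> T -> R) : (forall i, continuous (u i)) ->
    continuous (fun t => \sum_(i <- r) u i t).
  move=> cu; elim: r => [|i r ih].
    rewrite (_ : (fun _ => _) = cst 0); first exact: cst_continuous.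
    by apply/funext => t; rewrite big_nil.
  rewrite (_ : (fun _ => _) = u i \+ (fun t => \sum_(i <- r) u i t)).
    by move=> t; apply: continuousD; [exact: cu|exact: ih].
  by apply/funext => t; rewrite big_cons.
have cN : continuous (fun t : T =>
    beta%:num * normc (val (disc_segment z w t)) ^+ 2 : R).
  by apply: scale; apply: sqr; exact: continuous_normc_segment.
have cE : continuous (fun t : T =>
    \sum_(i < n) normc (h2_eval (g i) (disc_segment z w t)) ^+ 2).
  by apply: sum => i; apply: sqr; exact: continuous_normc_eval.
have cB : continuous (fun t : T =>
    1 - beta%:num * normc (val (disc_segment z w t)) ^+ 2 : R).
  exact: sub1 cN.
by move=> t; have := continuousM (cB t) (cE t); apply.
Qed.

Lemma berezin_ivt (n : nat) (g : 'I_n -> h2 beta) (z w : disc R)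
    (t : R) :
  0 <= t <= 1 -> exists v : disc R,
  berezin_real g v = t * berezin_real g z + (1 - t) * berezin_real g w.
Proof.
move=> /andP[t0 t1].
have [|s _ <-] := IVT (v := t * berezin_real g z + (1 - t) * berezin_real g w)
    ler01 (@continuous_berezin_real n g z w); last first.
  by exists (disc_segment z w s).
rewrite disc_segment0 disc_segment1 ge_min le_max.
move: (berezin_real g z) (berezin_real g w) => x y.
by case: (leP x y) => xy; apply/andP; split; apply/orP;
  (left; nra) || (right; nra).
Qed.

End segment.

Theorem theorem4p10 (R : realType) (beta : oc01 R) (n : nat)
    (g : 'I_n -> h2 beta) :
  convex_set (berezin_range (fun f : h2 beta => \sum_(i < n) h2_dot f (g i) *: g i)
    : set (Rcomplex R)).
Proof.
move=> x y t /set_mem[z _ <-] /set_mem[w _ <-]; apply/mem_set.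
have t01 : 0 <= t%:num <= 1 by rewrite ge0 le1.
have [v vE] := berezin_ivt g z w t01.
exists v => //; rewrite !berezin_sum_rank1 vE.
by apply/eqP; rewrite eq_complex/= !mulr0 addr0 !eqxx.
Qed.
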